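(* Every finite simple $2$-regular graph admits an antimagic orientation.
   Context: A labeling of a digraph $D$ with $m$ arcs is a bijection from the set of arcs of $D$ to $\{1,2,\dots,m\}$. For a labeling, the vertex-sum of a vertex $u$ is the sum of the labels of all arcs entering $u$ minus the sum of the labels of all arcs leaving $u$. A labeling is antimagic if no two distinct vertices have the same vertex-sum. An orientation $D$ of a graph $G$ is antimagic if $D$ has an antimagic labeling; $G$ admits an antimagic orientation if some orientation of $G$ is antimagic. A graph is $2$-regular if every vertex has degree $2$ (equivalently, it is a disjoint union of cycles). *)

(* Defs.v *)
From mathcomp Require Import all_boot all_order all_algebra.

Set Implicit Arguments.
Unset Strict Implicit.
Unset Printing Implicit Defensive.

Import GRing.Theory.

(* A graph or digraph on the vertex set T is given by its adjacency relation. *)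

Definition simple_graph (T : finType) (e : rel T) : Prop :=
  symmetric e /\ irreflexive e.

Definition degree (T : finType) (e : rel T) (u : T) : nat :=
  #|[set v | e u v]|.

Definition regular (T : finType) (k : nat) (e : rel T) : Prop :=
  forall u, degree e u = k.

Definition arcs (T : finType) (d : rel T) : {set T * T} :=
  [set a | d a.1 a.2].

(* Every edge of e receives exactly one of its two directions in d, and d has
   no other arc. *)
Definition orientation (T : finType) (e d : rel T) : Prop :=
  (forall u v, e u v = d u v || d v u) /\
  (forall u v, ~~ (d u v && d v u)).

(* A bijection from the arcs of d onto {1, ..., m}, m the number of arcs; the
   values of f outside arcs d are irrelevant. *)
Definition labeling (T : finType) (d : rel T) (f : T * T -> nat) : Prop :=
  {in arcs d &, injective f} /\
  (forall k, (1 <= k <= #|arcs d|) <-> exists2 a, a \in arcs d & f a = k).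

Definition vertex_sum (T : finType) (d : rel T) (f : T * T -> nat) (u : T)
    : int :=
  (\sum_(a in arcs d | a.2 == u) (f a)%:Z
   - \sum_(a in arcs d | a.1 == u) (f a)%:Z)%R.

Definition antimagic_labeling (T : finType) (d : rel T) (f : T * T -> nat)
    : Prop :=
  labeling d f /\ injective (vertex_sum d f).

Definition antimagic (T : finType) (d : rel T) : Prop :=
  exists f : T * T -> nat, antimagic_labeling d f.

Definition admits_antimagic_orientation (T : finType) (e : rel T) : Prop :=
  exists d : rel T, orientation e d /\ antimagic d.

(* Main.v *)
Require Import Defs.
From mathcomp Require Import all_boot all_order all_algebra.
From mathcomp Require Import zify.

Set Implicit Arguments.
Unset Strict Implicit.
Unset Printing Implicit Defensive.

Import GRing.Theory.

(** Number the edges of a cycle of length n by 0, ..., n-1 along the cycle and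
    orient them alternately: every vertex becomes a source or a sink, except
    that each odd cycle keeps one vertex at which the cycle passes through.
    Enumerate the edges of each cycle outwards from edges 0 and n-1 as
    0, n-1, 1, n-2, ...; the position in this list is the level of the edge.
    - Even cycles receive consecutive blocks of the largest labels, increasing
      with the level: all their vertices have distinct absolute sums.
    - The k odd cycles, sorted by length, are labelled level by level.  At the
      passing vertex of cycle i (counted from 0) the labels are 2k - 2i and
      2i + 1, and level 2 receives 2k + 1 + i.  So the passing vertices have the
      distinct sums 2k - 4i - 1, smaller in absolute value than all the others;
      the sums of the levels 0 and 2 are 4k + 1 - i; and for two
      sources (or two sinks) that are not both of this kind, the smaller labels
      and the larger labels compare in the same way, so that the sums differ. *)

(** * Directing every cycle of the graph *)

Section DirectedTwoFactor.

Variables (T : finType) (e : rel T).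
Hypotheses (sym_e : symmetric e) (irr_e : irreflexive e) (reg_e : regular 2 e).

Let other v u := odflt u [pick w | e v w && (w != u)].

Let otherP v u : e v u ->
  [/\ e v (other v u), other v u != u
    & forall w, e v w -> w != u -> w = other v u].
Proof.
move=> evu; have /eqP := reg_e v.
rewrite /degree (cardsD1 u) inE evu add1n eqSS => /cards1P[w Ew].
have nbrE x : (e v x && (x != u)) = (x == w).
  by have /setP/(_ x) := Ew; rewrite !inE andbC.
have -> : other v u = w.
  rewrite /other; case: pickP => [x /=|/(_ w)]; last by rewrite nbrE eqxx.
  by rewrite nbrE => /eqP.
have /andP[evw wu] : e v w && (w != u) by rewrite nbrE.
by split=> // x evx xu; apply/eqP; rewrite -nbrE evx.
Qed.

Let otherK v u : e v u -> other v (other v u) = u.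
Proof.
move=> evu; have [evw wu _] := otherP evu.
have [_ _ uniq_w] := otherP evw.
by apply/esym/uniq_w; rewrite // eq_sym.
Qed.

(** One step of a walk along the cycle. The value at pairs that are not darts makes [turn] injective
    on all pairs, so that its orbits partition them. *)
Let turn (d : T * T) := if e d.1 d.2 then (d.2, other d.2 d.1) else d.
Let swap (d : T * T) := (d.2, d.1).
Let dart (d : T * T) := e d.1 d.2.

Let dart_turn d : dart (turn d) = dart d.
Proof.
rewrite /dart /turn; case: ifP => [ed|-> //].
by rewrite sym_e in ed; have [-> ] := otherP ed.
Qed.

Let dart_swap d : dart (swap d) = dart d.
Proof. exact: sym_e. Qed.

Let turn_swap d : dart d -> turn (swap (turn d)) = swap d.
Proof.
rewrite /dart /turn => ed; rewrite ed /= sym_e.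
have ed' := ed; rewrite sym_e in ed'; have [-> _ _] := otherP ed'.
by rewrite otherK.
Qed.

Let turn_inj : injective turn.
Proof.
move=> c d eq_cd; have := dart_turn c; rewrite eq_cd dart_turn.
case dd: (dart d) => dc; last by move: eq_cd; rewrite /turn -!/(dart _) dd -dc.
have: swap c = swap d by rewrite -(turn_swap dd) -eq_cd turn_swap.
by case: (c) (d) => [? ?] [? ?] [-> ->].
Qed.

(* Turning backwards from the reversed dart shows that a dart whose orbit
   contains its reversal leads, two steps closer, to another such dart. *)
Let turn_neq_swap k d : dart d -> iter k turn d != swap d.
Proof.
have [m] := ubnP k; elim: m k d => // m IHm [|[|k]] d lt_km dd.
- by apply: contraTneq dd => /(congr1 fst) /= Ed; rewrite /dart Ed irr_e.
- have ed : e d.2 d.1 by rewrite sym_e.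
  rewrite /= /turn -/(dart d) dd; have [_ nd _] := otherP ed.
  by apply: contra nd => /eqP/(congr1 snd) /= ->.
apply: contra (IHm k (turn d) _ _) => [/eqP Ed||]; last 2 first.
- exact: ltnW.
- by rewrite dart_turn.
by apply/eqP/turn_inj; rewrite turn_swap // -Ed -iterSr.
Qed.

(* Of the two orbits formed by a cycle and its reversal, [pos] selects one. *)
Let rk d := enum_rank (froot turn d) : nat.
Let pos d := dart d && (rk d < rk (swap d)).

Let rk_turn d : rk (turn d) = rk d.
Proof.
congr (enum_rank _ : nat); apply/eqP.
rewrite (root_connect (fconnect_sym turn_inj)) (fconnect_sym turn_inj).
exact: fconnect1.
Qed.

Let rk_swap_neq d : dart d -> rk d != rk (swap d).
Proof.
move=> dd; apply: contraTneq dd => /val_inj/enum_rank_inj/eqP.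
rewrite (root_connect (fconnect_sym turn_inj)) => /iter_findex Ed.
by apply/negP => dd; have /eqP[] := turn_neq_swap (findex turn d (swap d)) dd.
Qed.

Let pos_swap d : dart d -> pos (swap d) = ~~ pos d.
Proof.
move=> dd; rewrite /pos dart_swap dd /=.
have -> : swap (swap d) = d by case: d {dd}.
by have := rk_swap_neq dd; case: ltngtP.
Qed.

Let pos_turn d : pos (turn d) = pos d.
Proof.
rewrite /pos dart_turn rk_turn; case dd: (dart d) => //=.
by rewrite -[in rk (swap d)](turn_swap dd) rk_turn.
Qed.

Lemma directed_two_factor :
  exists2 f : T -> T, injective f & forall u v, e u v = (f u == v) || (f v == u).
Proof.
have nextP u : exists v, pos (u, v).
  have /eqP := reg_e u; rewrite /degree => Eu.
  have [v] : exists v, v \in [set v | e u v].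
    by apply/set0Pn; rewrite -card_gt0 (eqP Eu).
  rewrite inE => euv; have [euw wv _] := otherP euv.
  case pv: (pos (u, v)); first by exists v.
  exists (other u v).
  (* The second dart leaving [u] is the [turn] of the reversal of the first, so exactly one of the
     two is selected. *)
  have -> : (u, other u v) = turn (v, u) by rewrite /turn /= sym_e euv.
  by rewrite pos_turn (pos_swap (d := (u, v))) ?pv.
pose f u := xchoose (nextP u).
have fP u : pos (u, f u) := xchooseP (nextP u).
have ef u : e u (f u) by case/andP: (fP u).
have turnf u : turn (u, f u) = (f u, other (f u) u) by rewrite /turn /= ef.
have posE u v : pos (u, v) -> v = f u.
  move=> puv; have euv : e u v by case/andP: (puv).
  have [//|nv] := eqVneq v (f u).
  have [_ _ /(_ v euv nv) Ev] := otherP (ef u).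
  have := pos_turn (f u, u); rewrite /turn /= sym_e ef -Ev puv.
  by rewrite (pos_swap (d := (u, f u))) ?fP // /dart ef.
have othf u : other (f u) u = f (f u).
  by apply: posE; rewrite -turnf pos_turn.
exists f => [u v Euv|u v].
  (* The predecessor of [f u] is its neighbour other than [f (f u)], hence determined by [f u]. *)
  have /= fu := ef u; rewrite sym_e in fu.
  have /= fv := ef v; rewrite sym_e in fv.
  by rewrite -(otherK fu) -(otherK fv) !othf Euv.
apply/idP/orP => [euv|[]/eqP<-]; [|exact: (ef u)|by rewrite sym_e; exact: (ef v)].
case puv: (pos (u, v)); first by left; rewrite -(posE _ _ puv).
right; apply/eqP/esym/posE.
by rewrite (pos_swap (d := (u, v))) ?puv.
Qed.

End DirectedTwoFactor.

(** * Ranks of injective keys *)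

Section Rank.

Variables (T : finType) (K : T -> nat).
Hypotheses (K_inj : injective K) (K_gt0 : forall u, 0 < K u).

Definition rank u := #|[set v | K v <= K u]|.

Lemma leq_rank u v : (rank u <= rank v) = (K u <= K v).
Proof.
have homo x y : K x <= K y -> rank x <= rank y.
  by move=> le_xy; apply/subset_leq_card/subsetP => w; rewrite !inE => /leq_trans->.
apply/idP/idP => [|/homo//]; apply: contraTT; rewrite -!ltnNge => lt_vu.
apply/proper_card/properP; split; last by exists u; rewrite !inE // -ltnNge.
by apply/subsetP => w; rewrite !inE => /leq_trans-> //; apply: ltnW.
Qed.

Lemma ltn_rank u v : (rank u < rank v) = (K u < K v).
Proof. by rewrite ltnNge leq_rank -ltnNge. Qed.

Lemma rank_inj : injective rank.
Proof.
move=> u v Euv; apply: K_inj; apply/eqP.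
by rewrite eqn_leq -!leq_rank Euv leqnn.
Qed.

Lemma rank_gt0 u : 0 < rank u.
Proof. by apply/card_gt0P; exists u; rewrite inE. Qed.

Lemma rank_le_card u : rank u <= #|T|.
Proof. exact: max_card. Qed.

Lemma rank_surj c : 0 < c <= #|T| -> exists u, rank u = c.
Proof.
move=> c_bounds; pose s := [seq rank u | u <- enum T].
have us : uniq s by rewrite map_inj_uniq ?enum_uniq //; apply: rank_inj.
have sub : {subset s <= iota 1 #|T|}.
  move=> _ /mapP[u _ ->]; rewrite mem_iota add1n ltnS.
  by rewrite rank_gt0 rank_le_card.
have [|_ Es] := uniq_min_size us sub; first by rewrite size_iota size_map -cardE.
have: c \in s by rewrite Es mem_iota add1n ltnS.
by case/mapP=> u _ ->; exists u.
Qed.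

(** The keys up to [K u] are distinct numbers between 1 and [K u]. *)
Lemma rank_le_key u : rank u <= K u.
Proof.
pose s := [seq K v | v <- enum [set v | K v <= K u]].
have us : uniq s by rewrite map_inj_uniq ?enum_uniq.
have: {subset s <= iota 1 (K u)}.
  move=> c /mapP[v]; rewrite mem_enum inE => le_vu ->.
  by rewrite mem_iota K_gt0 add1n ltnS.
by move=> /(uniq_leq_size us); rewrite size_map size_iota /rank cardE.
Qed.

(** With [rank_le_key], this makes rank and key agree as long as the keys have no gaps. *)
Lemma rank_ge c u : (forall b, 0 < b <= c -> exists v, K v = b) -> c <= K u ->
  c <= rank u.
Proof.
move=> att le_cu; rewrite -(size_iota 1 c).
pose s := [seq K v | v <- enum [set v | K v <= K u]].
have ->: rank u = size s by rewrite size_map -cardE.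
apply: uniq_leq_size (iota_uniq _ _) _ => b; rewrite mem_iota add1n ltnS => b_c.
have [v Kv] := att b b_c; apply/mapP; exists v => //.
by rewrite mem_enum inE Kv; case/andP: b_c => _ /leq_trans->.
Qed.

End Rank.

(** * From labels on the edges [u -- f u] to an antimagic orientation *)

Section EdgeLabeling.

Variables (T : finType) (e : rel T) (f : T -> T).
Hypotheses (f_inj : injective f) (f_n2 : forall u, f (f u) != u).
Hypothesis (eE : forall u v, e u v = (f u == v) || (f v == u)).

Variables (o : pred T) (g : T -> nat).
Hypothesis g_inj : injective g.
Hypothesis g_img : forall c, 0 < c <= #|T| <-> exists u, g u = c.

(* The sum at the vertex [f u], which is incident with the edges [u -- f u] and
   [f u -- f (f u)]; [o u] says that [u -- f u] is directed from [u] to [f u]. *)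
Definition signed_sum u : int :=
  ((if o u then (g u)%:Z else - (g u)%:Z) +
   (if o (f u) then - (g (f u))%:Z else (g (f u))%:Z))%R.

Let f_nfix u : f u != u.
Proof. by apply: contra (f_n2 u) => /eqP fu; rewrite !fu. Qed.

Let arc u := if o u then (u, f u) else (f u, u).

(** As [f] has no cycle of length 2, an edge, in either direction, is [v -- f v] for only one
    [v]. *)
Let arc_edge u v : arc u = (v, f v) \/ arc u = (f v, v) -> u = v.
Proof.
rewrite /arc; case: ifP => _ [] [] // E1 E2.
  by have := f_n2 v; rewrite -E1 E2 eqxx.
by have := f_n2 v; rewrite -E2 E1 eqxx.
Qed.

Let arc_inj : injective arc.
Proof.
move=> u v Euv; apply: arc_edge; rewrite Euv /arc.
by case: ifP; [left | right].
Qed.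

Let d : rel T := fun u v => [exists w, arc w == (u, v)].

Let dP u v : reflect (exists w, arc w = (u, v)) (d u v).
Proof. by apply: (iffP existsP) => -[w /eqP Ew]; exists w. Qed.

Let arcsE : arcs d = arc @: [set: T].
Proof.
apply/setP=> -[u v]; rewrite inE; apply/dP/imsetP => /= [[w Ew]|[w _ ->]].
  by exists w; rewrite ?inE.
by exists w.
Qed.

Let card_arcs : #|arcs d| = #|T|.
Proof. by rewrite arcsE card_imset ?cardsT. Qed.

Let lab (a : T * T) := if f a.1 == a.2 then g a.1 else g a.2.

Let lab_arc u : lab (arc u) = g u.
Proof. by rewrite /lab /arc; case: (o u); rewrite /= ?eqxx // (negPf (f_n2 u)). Qed.

Let orientation_d : orientation e d.
Proof.
split=> u v.
  rewrite eE; apply/orP/orP => [[]/eqP<-|[]/dP[w]].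
  - by case ou: (o u); [left | right]; apply/dP; exists u; rewrite /arc ou.
  - by case ov: (o v); [right | left]; apply/dP; exists v; rewrite /arc ov.
  - by rewrite /arc; case: ifP => _ [<- <-]; rewrite eqxx; auto.
  - by rewrite /arc; case: ifP => _ [<- <-]; rewrite eqxx; auto.
apply/negP => /andP[/dP[w Ew] /dP[x Ex]].
have wx : x = w.
  apply: arc_edge; rewrite Ex; move: Ew; rewrite /arc.
  by case: ifP => _ [-> ->]; auto.
move: Ex; rewrite wx Ew => -[uv _]; move: Ew; rewrite uv /arc.
by case: ifP => _ [E1 E2]; have /eqP[] := f_nfix w; congruence.
Qed.

Let labeling_d : labeling d lab.
Proof.
split=> [a b|c].
  by rewrite arcsE => /imsetP[u _ ->] /imsetP[v _ ->]; rewrite !lab_arc => /g_inj->.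
rewrite card_arcs g_img arcsE; split=> [[u <-]|[_ /imsetP[u _ ->]]].
  by exists (arc u); rewrite ?lab_arc // imset_f.
by rewrite lab_arc; exists u.
Qed.

Let vertex_sumE u : vertex_sum d lab (f u) = signed_sum u.
Proof.
rewrite /vertex_sum arcsE !big_imset_cond; try by move=> ? ? _ _; apply: arc_inj.
rewrite (eq_bigl (fun w => (arc w).2 == f u)); last by move=> w; rewrite inE.
rewrite [X in (_ - X)%R](eq_bigl (fun w => (arc w).1 == f u));
  last by move=> w; rewrite inE.
rewrite [X in (X - _)%R]big_mkcond [X in (_ - X)%R]big_mkcond -sumrB.
(* Only the edges indexed by [u] and [f u] meet the vertex [f u]. *)
rewrite (bigD1 u) // (bigD1 (f u)) //= big1 => [|w /andP[nwu nwfu]].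
  rewrite addr0 !lab_arc /signed_sum /arc.
  case: (o u); case: (o (f u));
    rewrite /= !eqxx ?(negPf (f_nfix _)) ?[u == f u]eq_sym
      ?(negPf (f_nfix _)) ?subr0 ?sub0r //.
have nfw : (f w == f u) = false by apply/eqP => /f_inj/eqP; apply/negP.
by rewrite /arc; case: (o w); rewrite /= nfw (negPf nwfu) subr0.
Qed.

Lemma antimagic_of_signed_sum :
  injective signed_sum -> admits_antimagic_orientation e.
Proof.
move=> sum_inj; exists d; split=> //; exists lab; split=> // u v.
have onto w : exists x, w = f x by exists (invF f_inj w); rewrite f_invF.
by have [[x ->] [y ->]] := (onto u, onto v); rewrite !vertex_sumE => /sum_inj->.
Qed.

End EdgeLabeling.

(** * Levels of the edges around one cycle *)

Section Zigzag.

Variable n : nat.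

Definition zigzag j := if j.*2 < n then j.*2 else (n - j).*2.-1.
Definition cyc_succ j := if j.+1 < n then j.+1 else 0.
Definition zig_lo j := minn (zigzag j) (zigzag (cyc_succ j)).
Definition zig_hi j := maxn (zigzag j) (zigzag (cyc_succ j)).

Lemma zigzag_lt j : j < n -> zigzag j < n.
Proof. rewrite /zigzag; do ?case: ifP; lia. Qed.

Lemma zigzag_inj i j : i < n -> j < n -> zigzag i = zigzag j -> i = j.
Proof. rewrite /zigzag; do ?case: ifP; lia. Qed.

Lemma zig_lo_inj i j : i.+1 < n -> j.+1 < n -> zig_lo i = zig_lo j -> i = j.
Proof. rewrite /zig_lo /zigzag /cyc_succ; do ?case: ifP; lia. Qed.

Lemma zig_lo_bound j : j.+1 < n -> zig_lo j < n.-1.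
Proof. rewrite /zig_lo /zigzag /cyc_succ; do ?case: ifP; lia. Qed.

(** Neighbouring edges on one side of the list are two levels apart; the sides meet at levels
    [n - 2] and [n - 1]. The bound on [j] leaves out the vertex with levels 0 and 1. *)
Lemma zig_hiE j : j.+1 < n -> zig_hi j = minn (zig_lo j).+2 n.-1.
Proof. rewrite /zig_lo /zig_hi /zigzag /cyc_succ; do ?case: ifP; lia. Qed.

(** The parity of [j], hence the sign of the vertex, depends on the lower level and not on [n]: it
    changes after the levels 0, 2, 4, ... *)
Lemma odd_zig_lo j : odd n -> j.+1 < n ->
  odd j = odd (uphalf (zig_lo j)).
Proof. rewrite /zig_lo /zigzag /cyc_succ; do ?case: ifP; lia. Qed.

(** The pairs of levels form the chain (0,1), (0,2), (1,3), ..., (n-3,n-1), (n-2,n-1). *)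
Lemma zig_total i j : 2 < n -> ~~ odd n -> i < n -> j < n ->
  (zig_lo i <= zig_lo j) && (zig_hi i <= zig_hi j) ||
  (zig_lo j <= zig_lo i) && (zig_hi j <= zig_hi i).
Proof. rewrite /zig_lo /zig_hi /zigzag /cyc_succ; do ?case: ifP; lia. Qed.

Lemma zig_lohi_inj i j : 2 < n -> i < n -> j < n ->
  zig_lo i = zig_lo j -> zig_hi i = zig_hi j -> i = j.
Proof. rewrite /zig_lo /zig_hi /zigzag /cyc_succ; do ?case: ifP; lia. Qed.

End Zigzag.

(** * Keys on the odd cycles *)

Section OddKey.

Variable k : nat.

(** For [i < k], levels 0 and 1 interleave to fill 1, ..., 2k, level 0 decreasing in [i]; a level
    [a >= 2] lies in ak + 1, ..., ak + k. Levels missing on short cycles leave gaps, which ranking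
    closes. *)
Definition odd_key a i :=
  match a with 0 => (k - i).*2 | 1 => i.*2.+1 | _ => a * k + i.+1 end.

Lemma odd_key_level a b i i' : i < k -> a < b -> 1 < b -> odd_key a i < odd_key b i'.
Proof. by case: a => [|[|a]]; case: b => [|[|b]] //=; nia. Qed.

Lemma odd_key_idx a i i' : 0 < a -> i < i' -> odd_key a i < odd_key a i'.
Proof. by case: a => [|[|a]] //=; nia. Qed.

Lemma odd_key_idxW a i i' : 0 < a -> i <= i' -> odd_key a i <= odd_key a i'.
Proof. by case: a => [|[|a]] //=; nia. Qed.

Lemma odd_key_gt0 a i : i < k -> 0 < odd_key a i.
Proof. by case: a => [|[|a]] //=; nia. Qed.

Lemma odd_key_le a i : i < k -> odd_key a i <= maxn 2 a.+1 * k.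
Proof. by case: a => [|[|a]] //=; nia. Qed.

Lemma odd_key_inj a b i i' : i < k -> i' < k -> odd_key a i = odd_key b i' ->
  a = b /\ i = i'.
Proof.
wlog le_ab : a b i i' / a <= b => [IH|] ik i'k.
  case: (leqP a b) => [|/ltnW] le E; first exact: IH.
  by have [] := IH _ _ _ _ le i'k ik (esym E).
have [lt_ab|ge_ab] := ltnP a b.
  have [b1|b1] := ltnP 1 b; first by have := odd_key_level i' ik lt_ab b1; lia.
  (* Levels 0 and 1 remain, whose keys differ in parity. *)
  have [-> ->] : a = 0 /\ b = 1 by lia.
  by rewrite /=; lia.
have -> : b = a by lia.
by case: a {le_ab ge_ab} => [|[|a]] /=; lia.
Qed.

End OddKey.

(** * Coordinates along the cycles *)

Section Cycles.

Variables (T : finType) (f : T -> T).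
Hypotheses (f_inj : injective f) (f_n2 : forall u, f (f u) != u).

Local Notation root := (froot f).

(** A vertex [u] also names the edge from [u] to [f u], so [pos] numbers the edges of each cycle as
    well. *)
Definition pos u := findex f (froot f u) u.
Definition len u := order f (froot f u).

Lemma froot_f u : froot f (f u) = froot f u.
Proof.
apply/eqP; rewrite (root_connect (fconnect_sym f_inj)) (fconnect_sym f_inj).
exact: fconnect1.
Qed.

Let root_conn u : fconnect f (froot f u) u.
Proof. by rewrite (fconnect_sym f_inj) connect_root. Qed.

Lemma pos_lt u : pos u < len u.
Proof. exact/findex_max/root_conn. Qed.

Lemma iter_pos u : iter (pos u) f (froot f u) = u.
Proof. exact/iter_findex/root_conn. Qed.

Lemma coord_inj u v : froot f u = froot f v -> pos u = pos v -> u = v.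
Proof. by move=> Er Ep; rewrite -(iter_pos u) Er Ep iter_pos. Qed.

Lemma len_f u : len (f u) = len u.
Proof. by rewrite /len froot_f. Qed.

Lemma pos_f u : pos (f u) = cyc_succ (len u) (pos u).
Proof.
rewrite /pos froot_f -/(pos u) /cyc_succ -[X in findex _ _ (f X)]iter_pos -iterS.
case: ltnP => [/findex_iter-> //|ge_len].
have -> : (pos u).+1 = len u by apply/eqP; rewrite eqn_leq ge_len pos_lt.
by rewrite iter_order // findex0.
Qed.

Lemma len_gt2 u : 2 < len u.
Proof.
rewrite /len; set r := froot f u; have := iter_order f_inj r.
have := order_gt0 f r; case: (order f r) => [|[|[|m]]] //= _ E.
  by have := f_n2 r; rewrite !E eqxx.
by have := f_n2 r; rewrite E eqxx.
Qed.

Lemma len_le_card u : len u <= #|T|.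
Proof. exact: max_card. Qed.

Definition odd_roots :=
  sort (fun r r' => order f r <= order f r')
    [seq r <- enum T | (froot f r == r) && odd (order f r)].

Local Notation k := (size odd_roots).
Definition idx u := index (froot f u) odd_roots.

Lemma mem_odd_roots r : (r \in odd_roots) = (froot f r == r) && odd (order f r).
Proof. by rewrite mem_sort mem_filter mem_enum andbT. Qed.

Lemma froot_odd u : odd (len u) -> froot f u \in odd_roots.
Proof. by rewrite mem_odd_roots (root_root (fconnect_sym f_inj)) eqxx. Qed.

Lemma idx_lt u : odd (len u) -> idx u < k.
Proof. by move=> ou; rewrite index_mem froot_odd. Qed.

Lemma idx_inj u v : odd (len u) -> idx u = idx v -> froot f u = froot f v.
Proof.
move=> ou Euv; have := idx_lt ou; rewrite {1}Euv index_mem => fv.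
by rewrite -(nth_index u (froot_odd ou)) -/(idx u) Euv nth_index.
Qed.

Lemma len_mono u v : odd (len u) -> odd (len v) -> idx u <= idx v -> len u <= len v.
Proof.
move=> ou ov; rewrite leq_eqVlt => /orP[/eqP/(idx_inj ou)|lt_uv].
  by rewrite /len => ->.
have := @sorted_ltn_index _ (fun r r' => order f r <= order f r').
move=> /(_ _ odd_roots); apply=> //; rewrite ?froot_odd //.
- by move=> y x z; apply: leq_trans.
- by apply: sort_sorted => x y; apply: leq_total.
Qed.

Lemma odd_cycle_vertex i : i < k ->
  exists n, [/\ odd n, 2 < n
    & forall j, j < n -> exists u, [/\ len u = n, idx u = i & pos u = j]].
Proof.
move=> ik; have [x0 _] : exists x0, x0 \in odd_roots.
  by case: odd_roots ik => // x0 ? _; exists x0; rewrite mem_head.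
pose r := nth x0 odd_roots i.
have rs : r \in odd_roots by rewrite mem_nth.
have := rs; rewrite mem_odd_roots => /andP[/eqP rr or].
exists (order f r); split=> // [|j jr]; first by have := len_gt2 r; rewrite /len rr.
have Er : froot f (iter j f r) = r by elim: {jr}j => //= m; rewrite froot_f.
exists (iter j f r); rewrite /len /idx /pos Er findex_iter // index_uniq //.
by rewrite sort_uniq filter_uniq ?enum_uniq.
Qed.

(** * Keys and labels of the edges *)

Definition level u := zigzag (len u) (pos u).

(** All keys of odd cycles are at most [#|T| * k], and a block of [#|T|] values has room for the
    levels of any even cycle. *)
Definition key u :=
  if odd (len u) then odd_key k (level u) (idx u)
  else (#|T| * (k + enum_rank (root u)) + level u).+1.

Let level_lt u : level u < len u.
Proof. exact/zigzag_lt/pos_lt. Qed.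

Let level_inj u v : root u = root v -> level u = level v -> u = v.
Proof.
move=> Er; have El : len u = len v by rewrite /len Er.
rewrite /level El => /zigzag_inj Ep; apply: (coord_inj Er).
by apply: Ep; [rewrite -El|]; apply: pos_lt.
Qed.

Lemma key_odd_even u v : odd (len u) -> ~~ odd (len v) -> key u < key v.
Proof.
move=> ou ov; rewrite /key ou (negPf ov).
have iu := idx_lt ou; have := odd_key_le (level u) iu.
have := level_lt u; have := len_le_card u; have := len_gt2 u.
have : maxn 2 (level u).+1 * k <= #|T| * k ->
  odd_key k (level u) (idx u) <= maxn 2 (level u).+1 * k ->
  odd_key k (level u) (idx u) < (#|T| * (k + enum_rank (root v)) + level v).+1 by nia.
move=> H *; apply: H => //; apply: leq_mul => //; lia.
Qed.

Lemma key_even u v : ~~ odd (len u) -> ~~ odd (len v) ->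
  enum_rank (root u) < enum_rank (root v) -> key u < key v.
Proof.
move=> ou ov; rewrite /key (negPf ou) (negPf ov).
have := leq_trans (level_lt u) (len_le_card u).
move: (level u) (level v) (nat_of_ord _) (nat_of_ord _) => a b x y; nia.
Qed.

Lemma key_inj : injective key.
Proof.
move=> u v; case ou: (odd (len u)); case ov: (odd (len v)).
- rewrite /key ou ov => /(odd_key_inj (idx_lt ou) (idx_lt ov))[El Ei].
  exact: level_inj (idx_inj ou Ei) El.
- by move=> E; have := key_odd_even ou (negbT ov); rewrite E ltnn.
- by move=> E; have := key_odd_even ov (negbT ou); rewrite E ltnn.
have := key_even (negbT ou) (negbT ov); have := key_even (negbT ov) (negbT ou).
case: (ltngtP (enum_rank (root u)) (enum_rank (root v))) => [_ _|_|].
- by move=> /(_ isT) + E; rewrite E ltnn.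
- by move=> /(_ isT) + _ E; rewrite E ltnn.
move=> /val_inj/enum_rank_inj Er _ _ E; apply: level_inj => //.
by move: E; rewrite /key ou ov Er; lia.
Qed.

Lemma key_gt0 u : 0 < key u.
Proof.
by rewrite /key; case: ifP => // ou; apply/odd_key_gt0/idx_lt.
Qed.

(** Every odd cycle has at least three edges, so the levels 0, 1, 2 are complete and fill 1, ...,
    3k. *)
Lemma key_attained c : 0 < c <= 3 * k -> exists u, key u = c.
Proof.
move=> c_bd.
have [i [ik [a [a2 <-]]]] : exists i, i < k /\ exists a, a < 3 /\ odd_key k a i = c.
  have [c2|c2] := leqP c k.*2.
    case oc: (odd c).
      by exists c./2; split; [lia | exists 1; split=> //=; lia].
    by exists (k - c./2); split; [lia | exists 0; split=> //=; lia].
  by exists (c - k.*2).-1; split; [lia | exists 2; split=> //=; lia].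
(* The levels 0, 1 and 2 belong to the edges 0, [n - 1] and 1. *)
pose j n := if a == 1 then n.-1 else a./2.
have [n [on n2 nP]] := odd_cycle_vertex ik.
have [|u [El Ei Ep]] := nP (j n); first by rewrite /j; case: eqP; lia.
exists u; rewrite /key El on Ei /level El Ep.
congr odd_key; rewrite /j /zigzag; do ?case: ifP; lia.
Qed.

Definition label u := rank key u.

Lemma label_exact u : key u <= 3 * k -> label u = key u.
Proof.
move=> le_u; rewrite /label; apply/eqP; rewrite eqn_leq (rank_le_key key_inj) //=; last first.
  by move=> v; apply: key_gt0.
apply: rank_ge => // b b_bd; apply: key_attained; lia.
Qed.

Lemma label_gt u : k.*2 < key u -> k.*2 < label u.
Proof.
have [k0|k_gt0] := posnP k; first by rewrite k0 => _; exact: rank_gt0.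
(* As [k > 0], the value [2k + 1] is still at most [3k], hence attained. *)
move=> lt_u; rewrite /label; apply: rank_ge => // b b_bd; apply: key_attained; lia.
Qed.

(** * Absolute sums at the vertices *)

Definition lo u := if level u <= level (f u) then u else f u.
Definition hi u := if level u <= level (f u) then f u else u.
(** The edges [u] and [f u] meet at the vertex [f u]; this is its absolute sum if it is a source or
    a sink. *)
Definition sum u := label (lo u) + label (hi u).

Lemma sumE u : label u + label (f u) = sum u.
Proof. by rewrite /sum /lo /hi; case: ifP => // _; rewrite addnC. Qed.

Let level_f u : level (f u) = zigzag (len u) (cyc_succ (len u) (pos u)).
Proof. by rewrite /level len_f // pos_f. Qed.

Let level_lo u : level (lo u) = zig_lo (len u) (pos u).
Proof. by rewrite /zig_lo -level_f /lo; case: leqP. Qed.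

Let level_hi u : level (hi u) = zig_hi (len u) (pos u).
Proof. by rewrite /zig_hi -level_f /hi; case: leqP. Qed.

Let root_lo u : root (lo u) = root u.
Proof. by rewrite /lo; case: ifP => // _; apply: froot_f. Qed.

Let root_hi u : root (hi u) = root u.
Proof. by rewrite /hi; case: ifP => // _; apply: froot_f. Qed.

Let len_lo u : len (lo u) = len u. Proof. by rewrite /len root_lo. Qed.
Let len_hi u : len (hi u) = len u. Proof. by rewrite /len root_hi. Qed.
Let idx_lo u : idx (lo u) = idx u. Proof. by rewrite /idx root_lo. Qed.
Let idx_hi u : idx (hi u) = idx u. Proof. by rewrite /idx root_hi. Qed.

(** Labels are ordered like keys, so one strict inequality suffices; on a common cycle, two
    equalities would force [u = v]. *)
Lemma sum_lt u v : key (lo u) <= key (lo v) -> key (hi u) <= key (hi v) ->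
  u != v ->
  root u = root v \/ key (lo u) < key (lo v) \/ key (hi u) < key (hi v) ->
  sum u < sum v.
Proof.
have lt x y : key x < key y -> label x < label y by rewrite /label ltn_rank.
have le x y : key x <= key y -> label x <= label y by rewrite /label leq_rank.
move=> le_lo le_hi neq_uv cmp; rewrite /sum.
have [Elo|] := eqVneq (key (lo u)) (key (lo v)); last first.
  move=> nlo; have /lt : key (lo u) < key (lo v) by lia.
  by have := le _ _ le_hi; lia.
have [Ehi|] := eqVneq (key (hi u)) (key (hi v)); last first.
  move=> nhi; have /lt : key (hi u) < key (hi v) by lia.
  by have := le _ _ le_lo; lia.
case: cmp => [Er|]; last lia.
case/eqP: neq_uv; apply: (coord_inj Er).
have El : len u = len v by rewrite /len Er.
apply: (@zig_lohi_inj (len u)); rewrite ?len_gt2 ?pos_lt //.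
- by rewrite El pos_lt.
- by rewrite -level_lo (key_inj Elo) level_lo El.
- by rewrite -level_hi (key_inj Ehi) level_hi El.
Qed.

Lemma sum_odd_even u v : odd (len u) -> ~~ odd (len v) -> sum u < sum v.
Proof.
move=> ou ov; have key_lt x y : len x = len u -> len y = len v -> key x < key y.
  by move=> Ex Ey; apply: key_odd_even; rewrite ?Ex ?Ey.
apply: sum_lt; rewrite ?(ltnW (key_lt _ _ _ _)) //.
  by apply: contraNneq ov => <-.
by right; left; apply: key_lt.
Qed.

(** Different even cycles have keys in disjoint blocks; within one cycle, [zig_total] makes the
    pairs comparable. *)
Lemma sum_even_inj u v : ~~ odd (len u) -> ~~ odd (len v) -> sum u = sum v -> u = v.
Proof.
wlog le_uv : u v / enum_rank (root u) <= enum_rank (root v) => [IH|] ou ov Es.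
  by case: (leqP (enum_rank (root u)) (enum_rank (root v))) => [|/ltnW] le;
    [|symmetry]; apply: IH.
apply/eqP/negPn/negP => neq_uv.
have [lt_uv|ge_uv] := ltnP (enum_rank (root u)) (enum_rank (root v)).
  have key_lt x y : root x = root u -> root y = root v -> key x < key y.
    by move=> Ex Ey; apply: key_even; rewrite // /len ?Ex ?Ey.
  suff: sum u < sum v by rewrite Es ltnn.
  apply: sum_lt; rewrite ?(ltnW (key_lt _ _ _ _)) //.
  by right; left; apply: key_lt.
have Er : root u = root v by apply/enum_rank_inj/val_inj/eqP; rewrite eqn_leq le_uv.
have El : len u = len v by rewrite /len Er.
have keyE x y : root x = root u -> root y = root u ->
    (key x <= key y) = (level x <= level y).
  move=> Ex Ey; rewrite /key /len Ex Ey -/(len u) (negPf ou); lia.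
have := zig_total (len_gt2 u) ou (pos_lt u) (j := pos v).
have -> : zig_lo (len u) (pos v) = level (lo v) by rewrite level_lo El.
have -> : zig_hi (len u) (pos v) = level (hi v) by rewrite level_hi El.
rewrite -level_lo -level_hi -!keyE ?root_lo ?root_hi // {1}El pos_lt.
move=> /(_ isT) => /orP[]/andP[le_lo le_hi].
  by have := sum_lt le_lo le_hi neq_uv (or_introl Er); rewrite Es ltnn.
rewrite eq_sym in neq_uv.
by have := sum_lt le_lo le_hi neq_uv (or_introl (esym Er)); rewrite Es ltnn.
Qed.

(** The cycle passes through [f u]: on an odd cycle the last edge and edge 0 both have even numbers,
    hence the same direction. *)
Definition passing u := odd (len u) && ((pos u).+1 == len u).

Let pos_nonpassing u : odd (len u) -> ~~ passing u -> (pos u).+1 < len u.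
Proof. by rewrite /passing => -> /=; have := pos_lt u; lia. Qed.

Lemma sum_odd_inj u v : odd (len u) -> odd (len v) -> ~~ passing u -> ~~ passing v ->
  odd (pos u) = odd (pos v) -> sum u = sum v -> u = v.
Proof.
wlog le_uv : u v /
    (level (lo u) < level (lo v)) ||
    (level (lo u) == level (lo v)) && (idx u <= idx v).
  move=> IH ou ov nu nv Eo Es.
  case: (ltngtP (level (lo u)) (level (lo v))) => cmp; [|symmetry|].
  - by apply: IH; rewrite ?cmp.
  - by apply: IH; rewrite ?cmp.
  by case: (leqP (idx u) (idx v)) => [|/ltnW] le;
    [|symmetry]; apply: IH; rewrite ?cmp ?eqxx ?le ?orbT.
move=> ou ov /(pos_nonpassing ou) pu /(pos_nonpassing ov) pv Eo Es.
have iu := idx_lt ou; have iv := idx_lt ov.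
have keyE x : odd (len x) -> key x = odd_key k (level x) (idx x).
  by rewrite /key => ->.
have Klou : key (lo u) = odd_key k (level (lo u)) (idx u).
  by rewrite keyE ?len_lo ?idx_lo.
have Klov : key (lo v) = odd_key k (level (lo v)) (idx v).
  by rewrite keyE ?len_lo ?idx_lo.
have Khiu : key (hi u) = odd_key k (level (hi u)) (idx u).
  by rewrite keyE ?len_hi ?idx_hi.
have Khiv : key (hi v) = odd_key k (level (hi v)) (idx v).
  by rewrite keyE ?len_hi ?idx_hi.
have bu := zig_lo_bound pu; have bv := zig_lo_bound pv.
have hu := zig_hiE pu; have hv := zig_hiE pv.
have := odd_zig_lo ou pu; have := odd_zig_lo ov pv; rewrite -Eo => {Eo} -> Eo.
rewrite -!level_lo -!level_hi in bu bv hu hv Eo.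
have gtu := len_gt2 u; have gtv := len_gt2 v.
case/orP: le_uv => [lt_lo|/andP[/eqP eq_lo le_i]].
  (* This could fail only with [lo v] at level [len v - 2], one above [lo u]; but then the parities
     in [Eo] differ. *)
  have lt_hi : level (hi u) < level (hi v) by lia.
  have klo : key (lo u) < key (lo v)
    by rewrite Klou Klov; apply: odd_key_level => //; lia.
  have khi : key (hi u) < key (hi v)
    by rewrite Khiu Khiv; apply: odd_key_level => //; lia.
  suff: sum u < sum v by rewrite Es ltnn.
  apply: sum_lt; rewrite ?(ltnW klo) ?(ltnW khi) //; last by right; left.
  by apply: contraTneq klo => ->; rewrite ltnn.
have [Ei|neq_i] := eqVneq (idx u) (idx v).
  have Er := idx_inj ou Ei; have El : len u = len v by rewrite /len Er.
  apply: (coord_inj Er); apply: (@zig_lo_inj (len u)) => //; first by rewrite El.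
  by rewrite -level_lo eq_lo level_lo El.
have lt_i : idx u < idx v by lia.
have le_len := len_mono ou ov le_i.
have [lo0|lo_gt0] := posnP (level (lo u)).
  (* Here the smaller keys decrease with the index while the larger ones increase, so the exact sums
     [4k + 1 - i] are compared. *)
  have [hi2u hi2v] : level (hi u) = 2 /\ level (hi v) = 2 by lia.
  move: Klou Klov Khiu Khiv Es; rewrite /sum -eq_lo lo0 hi2u hi2v /=.
  move=> Klou Klov Khiu Khiv.
  by rewrite !label_exact ?Klou ?Klov ?Khiu ?Khiv; lia.
have klo : key (lo u) < key (lo v) by rewrite Klou Klov -eq_lo; apply: odd_key_idx.
(* Sorting by length is needed here: the lower levels agree and [len u <= len v], so the upper level
   of [u] is at most that of [v]. *)
have khi : key (hi u) <= key (hi v).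
  have [le_hi|] := leqP (level (hi v)) (level (hi u)).
    have -> : key (hi u) = odd_key k (level (hi v)) (idx u).
      by rewrite Khiu; congr odd_key; lia.
    by rewrite Khiv odd_key_idxW //; lia.
  by move=> lt_hi; rewrite Khiu Khiv ltnW // odd_key_level //; lia.
suff: sum u < sum v by rewrite Es ltnn.
apply: sum_lt; rewrite ?(ltnW klo) ?khi //; last by right; left.
by apply: contraTneq klo => ->; rewrite ltnn.
Qed.

(** The larger edge lies on an even cycle or has level at least 2. This separates these vertices
    from the passing ones. *)
Lemma sum_gt u : 0 < k -> ~~ passing u -> k.*2 < sum u.
Proof.
move=> k_gt0 np; suff: k.*2 < label (hi u) by rewrite /sum; lia.
apply: label_gt; rewrite /key len_hi; case: ifP => [ou|_]; last first.
  rewrite ltnS; apply: leq_trans (leq_addr _ _); rewrite -mul2n leq_mul ?leq_addr //.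
  exact: leq_trans (ltnW (len_gt2 u)) (len_le_card u).
have pu := pos_nonpassing ou np; have iu := idx_lt ou.
have lu : 1 < level (hi u) by rewrite level_hi zig_hiE //; have := len_gt2 u; lia.
by case: (level (hi u)) lu => [|[|l]] //= _; nia.
Qed.

(** * Signed vertex sums and their injectivity *)

Local Notation vsum := (signed_sum f (fun u => odd (pos u)) label).

Lemma vsum_nonpassing u : ~~ passing u ->
  vsum u = (if odd (pos u) then (sum u)%:Z else - (sum u)%:Z)%R.
Proof.
rewrite /signed_sum -sumE pos_f // /cyc_succ /passing; have := pos_lt u.
case: (ltnP (pos u).+1) => [_ _ _|ge_len lt_len].
  by rewrite oddS; case: (odd (pos u)) => /=; lia.
(* At the wrap-around of an even cycle, the last edge is odd and edge 0 even, so the directions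
   still alternate. *)
have E : len u = (pos u).+1 by lia.
by rewrite E eqxx andbT /= negbK => ->; lia.
Qed.

Lemma vsum_passing u : passing u ->
  vsum u = (k.*2%:Z - (idx u).*2.*2%:Z - 1)%R /\ idx u < k.
Proof.
move=> /andP[ou /eqP pu]; have iu := idx_lt ou; split=> //.
have gtu := len_gt2 u; have ep : odd (pos u) = false by move: ou; rewrite -pu /=; lia.
have lu : level u = 1 by rewrite /level /zigzag; case: ifP; lia.
have lfu : level (f u) = 0.
  by rewrite level_f /cyc_succ pu ltnn /zigzag; case: ifP; lia.
have Ku : key u = (idx u).*2.+1 by rewrite /key ou lu.
have Kfu : key (f u) = (k - idx u).*2 by rewrite /key len_f // ou lfu /idx froot_f.
rewrite /signed_sum pos_f // /cyc_succ pu ltnn ep /= !label_exact; lia.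
Qed.

Lemma vsum_inj : injective vsum.
Proof.
(* Passing sums are below [2k] in absolute value, all others above. *)
have neq u v : passing u -> ~~ passing v -> vsum u <> vsum v.
  move=> pu nv; have [-> iu] := vsum_passing pu; rewrite vsum_nonpassing //.
  by have := sum_gt (leq_ltn_trans (leq0n _) iu) nv; case: ifP; lia.
move=> u v; have [pu|nu] := boolP (passing u); have [pv|nv] := boolP (passing v).
- have [-> _] := vsum_passing pu; have [-> _] := vsum_passing pv => Ei.
  have Er : root u = root v by apply: (idx_inj); [case/andP: pu | lia].
  apply: (coord_inj Er); move: pu pv.
  by rewrite /passing /len Er => /andP[_ /eqP + /andP[_ /eqP]]; lia.
- by move/(neq u v pu nv).
- by move/esym/(neq v u pv nu).
rewrite !vsum_nonpassing // => Ev.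
have sum_gt0 w : 0 < sum w by rewrite addn_gt0 !rank_gt0.
have := sum_gt0 u; have := sum_gt0 v => su sv.
(* Positive absolute sums let the sign be read off the signed sum. *)
have [Eo Es] : odd (pos u) = odd (pos v) /\ sum u = sum v.
  by move: Ev; case: (odd (pos u)); case: (odd (pos v)) => Ev; split=> //; lia.
case ou: (odd (len u)); case ov: (odd (len v)).
- exact: sum_odd_inj.
- by have := sum_odd_even ou (negbT ov); rewrite Es ltnn.
- by have := sum_odd_even ov (negbT ou); rewrite Es ltnn.
- exact: sum_even_inj (negbT ou) (negbT ov) Es.
Qed.

End Cycles.

(** * Assembling orientation and labeling *)

Theorem theorem2p1 (T : finType) (e : rel T) :
  simple_graph e -> regular 2 e -> admits_antimagic_orientation e.
Proof.
move=> [sym_e irr_e] reg_e.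
have [f f_inj eE] := directed_two_factor sym_e irr_e reg_e.
(* Otherwise [f u] would be the only neighbour of [u]. *)
have f_n2 u : f (f u) != u.
  apply/eqP => ffu; have := reg_e u; rewrite /degree.
  suff -> : [set v | e u v] = [set f u] by rewrite cards1.
  apply/setP => v; rewrite !inE eE eq_sym; case: eqVneq => //= nv.
  by apply/eqP => fv; case/eqP: nv; apply: f_inj; rewrite fv.
have key_inj := key_inj f_inj f_n2.
apply: (antimagic_of_signed_sum f_inj f_n2 eE _ _ (vsum_inj f_inj f_n2)).
  exact: rank_inj.
move=> c; split=> [|[u <-]]; first exact: rank_surj.
by rewrite rank_gt0 rank_le_card.
Qed.
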